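(* Let $d=2$ and let $E\subset[1,2]$ with $\dim_{\mathrm{M}}E=\beta$, $\dim_{\mathrm{qA}}E=\gamma$, $\dim_{\mathrm{A}}E=\gamma_*$, and let $M_Ef(x)=\sup_{t\in E}\left|\int_{\mathbb{S}^{1}}f(x-ty)\,d\sigma(y)\right|$. If $M_E$ is of radial restricted weak type $(p,2p)$, then $p\ge\max\{\frac{\beta+3}{2},\gamma_*+1\}$. Additionally, suppose that $E$ is quasi-Assouad regular and $2\gamma\ge\beta+1$. Then $\mathcal{T}^{rad}_E\subset\mathcal{Q}(\beta,\gamma)$.
   Context: $\sigma$ is the normalized arc-length measure on $\mathbb{S}^1$. $N(F,a)$ is the minimal number of intervals of length $a$ needed to cover $F$. $\dim_{\mathrm{M}}E=\inf\{a>0:\exists c,\ N(E,\delta)\le c\delta^{-a}\ \forall\delta\in(0,1)\}$; $\dim_{\mathrm{A}}E=\inf\{a>0:\exists c \text{ s.t. for all intervals } I,\ \delta\in(0,|I|),\ N(E\cap I,\delta)\le c(\delta/|I|)^{-a}\}$; $\overline{\dim}_{\mathrm{A},\theta}E=\inf\{a>0:\exists c \text{ s.t. } \forall\delta\in(0,1),\ \forall I, |I|\ge\delta^\theta,\ N(E\cap I,\delta)\le c(\delta/|I|)^{-a}\}$ for $\theta\in[0,1]$; $\dim_{\mathrm{qA}}E=\lim_{\theta\nearrow1}\overline{\dim}_{\mathrm{A},\theta}E$. $E$ is quasi-Assouad regular if either $\gamma=0$ or $\overline{\dim}_{\mathrm{A},\theta}E=\gamma$ for every $\theta\in(1-\beta/\gamma,1)$.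 $M_E$ is of radial restricted weak type $(p,q)$ if it is bounded from $L^{p,1}_{rad}(\mathbb{R}^2)$ (radial functions in the Lorentz space $L^{p,1}$) to $L^{q,\infty}(\mathbb{R}^2)$. $\mathcal{T}^{rad}_E=\{(1/p,1/q)\in[0,1]^2: M_E$ bounded $L^p_{rad}(\mathbb{R}^2)\to L^q(\mathbb{R}^2)\}$. In $d=2$: $O=(0,0)$, $Q_1(b)=(\frac1{1+b},\frac1{1+b})$, $Q_2(b)=(\frac2{3+b},\frac1{3+b})$; for $1\le\beta+1\le2\gamma\le2$, $\theta=\frac{1-\beta}{2(\gamma-\beta)}$ if $\beta<1$, $\theta=1$ if $\beta=\gamma=1$, $Q_3(\beta,\gamma)=\big(\frac{2-\beta(1-\theta)}{2(1+\gamma\theta)},\frac{1}{2(1+\gamma\theta)}\big)$, and $\mathcal{Q}(\beta,\gamma)$ is the closed quadrilateral with vertices $O,Q_1(\beta),Q_3(\beta,\gamma),Q_2(2\gamma-1)$. *)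

(* Defs.v *)
From HB Require Import structures.
From mathcomp Require Import all_boot all_order all_algebra.
From mathcomp Require Import all_classical all_reals all_analysis.
Set Implicit Arguments. Unset Strict Implicit. Unset Printing Implicit Defensive.
Import Order.TTheory GRing.Theory Num.Theory.
Import numFieldNormedType.Exports.
Local Open Scope classical_set_scope.
Local Open Scope ring_scope.

Section Defs.
Variable R : realType.

Definition coverN (F : set R) (delta : R) : \bar R :=
  ereal_inf [set (n%:R)%:E | n in
    [set n : nat | exists a : nat -> R,
       F `<=` \bigcup_(i in `I_n) [set y | a i <= y <= a i + delta]]].

Definition dimM (E : set R) : \bar R :=
  ereal_inf [set a%:E | a in [set a : R | 0 < a /\ exists c : R,
    forall delta, 0 < delta < 1 -> (coverN E delta <= (c * delta `^ (- a))%:E)%E]].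

Definition ival (x r : R) : set R := [set y | x <= y <= x + r].

Definition dimA (E : set R) : \bar R :=
  ereal_inf [set a%:E | a in [set a : R | 0 < a /\ exists c : R,
    forall (x r delta : R), 0 < delta < r ->
      (coverN (E `&` ival x r) delta
         <= (c * (delta / r) `^ (- a))%:E)%E]].

Definition dimAspec (E : set R) (theta : R) : \bar R :=
  ereal_inf [set a%:E | a in [set a : R | 0 < a /\ exists c : R,
    forall (delta x r : R), 0 < delta < 1 -> delta `^ theta <= r ->
      (coverN (E `&` ival x r) delta
         <= (c * (delta / r) `^ (- a))%:E)%E]].

(* Quasi-Assouad regularity (beta = dim_M E, gamma = dim_qA E). *)
Definition qA_regular (E : set R) (beta gamma : R) : Prop :=
  gamma = 0 \/
  (forall theta : R, 1 - beta / gamma < theta < 1 -> dimAspec E theta = gamma%:E).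

Definition norm2 (z : R * R) : R := Num.sqrt (z.1 ^+ 2 + z.2 ^+ 2).

Definition leb2 := (@lebesgue_measure R \x @lebesgue_measure R)%E.

Definition radial (f : R * R -> R) : Prop :=
  forall z w, norm2 z = norm2 w -> f z = f w.

(* continuous with compact support: the a priori class of test functions *)
Definition Cc (f : R * R -> R) : Prop :=
  continuous f /\ exists r : R, forall z, r < norm2 z -> f z = 0.

(* spherical mean: int_{S^1} f(x - t y) dsigma(y), sigma normalized arc length *)
Definition circavg (f : R * R -> R) (x : R * R) (t : R) : R :=
  (2 * pi)^-1 * Rintegral (@lebesgue_measure R) [set th : R | 0 <= th <= 2 * pi]
    (fun th => f (x.1 - t * cos th, x.2 - t * sin th)).

Definition maxE (E : set R) (f : R * R -> R) (x : R * R) : \bar R :=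
  ereal_sup [set (`|circavg f x t|)%:E | t in E].

Definition posR : set R := [set lam | 0 < lam].

Definition distf (g : R * R -> \bar R) (lam : R) : \bar R :=
  leb2 [set z | (lam%:E < `|g z|)%E].

Definition lorentz1 (p : R) (f : R * R -> R) : \bar R :=
  (p%:E * \int[@lebesgue_measure R]_(lam in posR)
            (distf (EFin \o f) lam) `^ p^-1)%E.

Definition weakL (q : R) (g : R * R -> \bar R) : \bar R :=
  ereal_sup [set (lam%:E * (distf g lam) `^ q^-1)%E | lam in posR].

Definition rad_restricted_weak (E : set R) (p q : R) : Prop :=
  exists C : R, forall f : R * R -> R, radial f -> Cc f ->
    (weakL q (maxE E f) <= C%:E * lorentz1 p f)%E.

Definition expo (u : R) : \bar R := if u == 0 then +oo%E else (u^-1)%:E.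

Definition rad_bounded (E : set R) (u v : R) : Prop :=
  exists C : R, forall f : R * R -> R, radial f -> Cc f ->
    (Lnorm leb2 (expo v) (maxE E f) <= C%:E * Lnorm leb2 (expo u) (EFin \o f))%E.

Definition Trad (E : set R) : set (R * R) :=
  [set uv | (0 <= uv.1 <= 1) /\ (0 <= uv.2 <= 1) /\ rad_bounded E uv.1 uv.2].

Definition ptO : R * R := (0, 0).
Definition ptQ1 (b : R) : R * R := ((1 + b)^-1, (1 + b)^-1).
Definition ptQ2 (b : R) : R * R := (2 / (3 + b), (3 + b)^-1).
Definition thetaQ (beta gamma : R) : R :=
  if beta < 1 then (1 - beta) / (2 * (gamma - beta)) else 1.
Definition ptQ3 (beta gamma : R) : R * R :=
  let th := thetaQ beta gamma in
  ((2 - beta * (1 - th)) / (2 * (1 + gamma * th)), (2 * (1 + gamma * th))^-1).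

Definition Quad (beta gamma : R) : set (R * R) :=
  [set z | exists a b c d : R, 0 <= a /\ 0 <= b /\ 0 <= c /\ 0 <= d /\
     a + b + c + d = 1 /\
     z.1 = a * ptO.1 + b * (ptQ1 beta).1 + c * (ptQ3 beta gamma).1
           + d * (ptQ2 (2 * gamma - 1)).1 /\
     z.2 = a * ptO.2 + b * (ptQ1 beta).2 + c * (ptQ3 beta gamma).2
           + d * (ptQ2 (2 * gamma - 1)).2].

End Defs.

(* Main.v *)
(** The maximal operator is tested on smoothed indicators of discs and annuli,
    which are radial. Write u = 1/p, v = 1/q.

    - On a disc of radius e, the maximal function is at least c e on the
      e-neighbourhoods of the circles of radius t in E, a set of measure
      comparable with e N(E, e). Hence e (e N(E, e))^v <= C e^(2u).
    - On an annulus of thickness e whose radius is at distance ~ r from an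
      interval I of length r, internal tangency of circles makes the maximal
      function at least c (e/r)^(1/2) on e-thin annuli of radius ~ r, one for
      each point of an e-separated subset of E in I. Hence
      (e/r)^(1/2) (r e N(E cap I, e))^v <= C e^u.
    - On a large disc one gets v <= u.

    For q = 2p the first two bounds read N(E, e) <= C e^(3-2p) and
    N(E cap I, e) <= C (e/r)^(1-p). In general the disc gives the line Q1 Q3,
    the annulus with r = e the line O Q2, and the annulus with
    r ~ e^(1 - beta/gamma), the scale at which quasi-Assouad regularity makes
    N(E cap I, e) ~ e^(-beta), the line Q2 Q3. *)

Require Import Defs.
From HB Require Import structures.
From mathcomp Require Import all_boot all_order all_algebra.
From mathcomp Require Import all_classical all_reals all_analysis.
From mathcomp Require Import measurable_realfun ess_sup_inf ring lra.
Import Order.TTheory GRing.Theory Num.Theory.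
Import numFieldNormedType.Exports.
Local Open Scope classical_set_scope.
Local Open Scope ring_scope.
Set Implicit Arguments. Unset Strict Implicit. Unset Printing Implicit Defensive.

(** * Monotonicity of integrals and measures *)

(** The integral of a nonnegative function is the supremum over the simple functions below it, and
    those below [f] are below [g]. In this form it serves for maximal functions and their superlevel
    sets. *)
Lemma le_integral_nonneg {d} {T : measurableType d} {R : realType}
    (mu : {measure set T -> \bar R}) (f g : T -> \bar R) :
  (forall x, 0 <= f x)%E -> (forall x, f x <= g x)%E ->
  (\int[mu]_x f x <= \int[mu]_x g x)%E.
Proof.
move=> f0 fg; have g0 x : (0 <= g x)%E by exact: le_trans (f0 x) (fg x).
rewrite !ge0_integralTE//; apply: ereal_sup_le => _ [h hf <-].
by exists h => //= x; exact: le_trans (hf x) (fg x).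
Qed.

Lemma lebesgue_measure_mono {R : realType} (A B : set R) :
  A `<=` B -> (@lebesgue_measure R A <= @lebesgue_measure R B)%E.
Proof. by move=> AB; apply: le_mu_ext. Qed.

Lemma leb2_mono {R : realType} (A B : set (R * R)) :
  A `<=` B -> (leb2 A <= leb2 B)%E.
Proof.
move=> AB; apply: le_integral_nonneg => [x|x]; first exact: measure_ge0.
by apply: lebesgue_measure_mono => y /=; rewrite /xsection/= !inE; exact: AB.
Qed.

(** * Norm bounds by comparison with indicators *)

Section Norms.
Context {d} {T : measurableType d} {R : realType}.
Variable mu : {measure set T -> \bar R}.

Lemma Lnorm_le_measure (u : R) (A : set T) (f : T -> R) :
  0 <= u -> measurable A -> (forall x, 0 <= f x <= 1) ->
  (forall x, f x != 0 -> A x) ->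
  (Lnorm mu (expo u) (EFin \o f) <= mu A `^ u)%E.
Proof.
move=> u0 mA f01 fA; rewrite unlock /expo.
(* [u = 0] encodes the exponent [+oo]: the norm is an essential supremum, and the zeroth power of
   [mu A] is 1. *)
have [->|un0] := eqVneq u 0.
  rewrite poweRe0; case: ifP => // _.
  apply/ess_supP; apply: nearW => x /=.
  by have /andP[f0 f1] := f01 x; rewrite lee_fin ger0_norm.
rewrite invrK; apply: gt0_ler_poweR => //.
- by rewrite in_itv/= leey integral_ge0// => x _; exact: poweR_ge0.
- by rewrite in_itv/= leey measure_ge0.
rewrite -[X in mu X](setIT A) -integral_indic//.
apply: le_integral_nonneg => [x|x] /=.
  by rewrite lee_fin powR_ge0.
rewrite lee_fin.
have /andP[f0 f1] := f01 x; rewrite ger0_norm//.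
have [fx|fx] := eqVneq (f x) 0; first by rewrite fx powR0 ?invr_neq0// indicE.
rewrite indicE mem_set/=; last exact: fA.
have -> : true%:R = 1 `^ u^-1 :> R by rewrite powR1.
by rewrite ge0_ler_powR ?invr_ge0// ?nnegrE.
Qed.

(** Chebyshev's inequality. At [v = 0] the norm is an essential supremum; if it were below [lam],
    the set [B] would be null. *)
Lemma Lnorm_ge_measure (v lam : R) (B : set T) (g : T -> \bar R) :
  0 <= v -> 0 <= lam -> measurable B -> (0 < mu B)%E ->
  (forall x, B x -> lam%:E <= `|g x|)%E ->
  (lam%:E * mu B `^ v <= Lnorm mu (expo v) g)%E.
Proof.
move=> v0 l0 mB B0 gB; rewrite unlock /expo.
have [->|vn0] := eqVneq v 0.
  rewrite poweRe0 mule1 ifT; last first.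
    by apply: (lt_le_trans B0); apply: le_measure; rewrite ?inE.
  rewrite leNgt; apply/negP => lt.
  have [N [mN N0 sN]] := ess_sup_ge mu (abse \o g).
  move: B0; rewrite lt_neqAle => /andP[/eqP + _]; apply.
  apply/esym/eqP; rewrite -measure_le0 -N0; apply: le_measure; rewrite ?inE//.
  move=> x Bx; apply: sN => /= le; have := le_lt_trans le lt.
  by rewrite ltNge (gB _ Bx).
rewrite invrK.
have -> : (lam%:E * mu B `^ v = ((lam `^ v^-1)%:E * mu B) `^ v)%E.
  rewrite poweRM ?lee_fin ?powR_ge0// poweR_EFin -powRrM mulVf// powRr1//.
apply: gt0_ler_poweR => //.
- by rewrite in_itv/= leey mule_ge0// lee_fin powR_ge0.
- by rewrite in_itv/= leey integral_ge0// => x _; exact: poweR_ge0.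
rewrite -integral_cst// integral_mkcond.
apply: le_integral_nonneg => [x|x] /=; rewrite patchE; case: ifPn => //.
- by rewrite lee_fin powR_ge0.
- rewrite inE => /gB le /=; rewrite -poweR_EFin; apply: gt0_ler_poweR => //.
  + by rewrite invr_ge0.
  + by rewrite in_itv/= leey lee_fin l0.
  + by rewrite in_itv/= leey abse_ge0.
- by move=> _; exact: poweR_ge0.
Qed.

End Norms.

(** The distribution function of [f] vanishes beyond level 1 and is at most [leb2 A] before it, so
    the integral runs over a unit interval. *)
Lemma lorentz1_le_measure {R : realType} (p : R) (A : set (R * R))
    (f : R * R -> R) :
  1 <= p -> (forall x, 0 <= f x <= 1) -> (forall x, f x != 0 -> A x) ->
  (lorentz1 p f <= p%:E * leb2 A `^ p^-1)%E.
Proof.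
move=> p1 f01 fA; have p0 : 0 < p by lra.
rewrite /lorentz1; apply: lee_wpmul2l; first by rewrite lee_fin ltW.
have h : (leb2 A `^ p^-1 =
    \int[lebesgue_measure]_(l in `]0%R, 1%R]) (cst (leb2 A `^ p^-1)) l)%E.
  by rewrite integral_cst//= lebesgue_measure_itv/= lte_fin ltr01 sube0 mule1.
rewrite h integral_mkcond [leRHS]integral_mkcond.
apply: le_integral_nonneg => [x|x]; rewrite /patch.
  by case: ifP => // _; exact: poweR_ge0.
case: ifPn => [|_]; last by case: ifP => // _; exact: poweR_ge0.
rewrite inE /posR/= => x0; case: ifPn => [_|].
  apply: gt0_ler_poweR; rewrite ?invr_ge0 ?(ltW p0) ?in_itv/= ?leey ?andbT//.
  apply: leb2_mono => z/=; rewrite lte_fin => xz; apply: fA.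
  by apply: contraTN xz => /eqP ->; rewrite normr0 -leNgt ltW.
move/negP; rewrite inE/= in_itv/= x0/= => /negP; rewrite -ltNge => x1.
rewrite /distf (_ : [set z | _] = set0); last first.
  apply/seteqP; split => z //=; rewrite lte_fin => xz.
  by have /andP[f0 f1] := f01 z; move: xz; rewrite ger0_norm//; lra.
have -> : @leb2 R set0 = 0%E by exact: measure0.
by rewrite poweR0r ?invr_eq0 ?gt_eqF.
Qed.

(** Superlevel sets in [weakL] are strict while [g] may equal [lam] on [B]; passing to the level
    [lam / 2] costs a factor 2. *)
Lemma weakL_ge_measure {R : realType} (q lam : R) (B : set (R * R))
    (g : R * R -> \bar R) :
  0 < q -> 0 < lam -> (forall x, B x -> lam%:E <= `|g x|)%E ->
  ((lam / 2)%:E * leb2 B `^ q^-1 <= weakL q g)%E.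
Proof.
move=> q0 l0 gB; rewrite /weakL.
apply: (@le_trans _ _ ((lam / 2)%:E * distf g (lam / 2) `^ q^-1)%E); last first.
  by apply: ereal_sup_ubound; exists (lam / 2) => //; rewrite /posR/=; lra.
apply: lee_wpmul2l; first by rewrite lee_fin; lra.
apply: gt0_ler_poweR; rewrite ?invr_ge0 ?(ltW q0) ?in_itv/= ?leey ?andbT//.
apply: leb2_mono => z /gB /=; apply: lt_le_trans; rewrite lte_fin; lra.
Qed.

(** * Areas of discs, annuli and quarter annuli *)

Section PlaneMeasure.
Context {R : realType}.
Implicit Types (x : R) (z : R * R).

Lemma norm2_ge0 z : 0 <= norm2 z.
Proof. exact: sqrtr_ge0. Qed.

Lemma sqr_norm2 z : norm2 z ^+ 2 = z.1 ^+ 2 + z.2 ^+ 2.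
Proof. by rewrite sqr_sqrtr// addr_ge0 ?sqr_ge0. Qed.

Lemma continuous_norm2 : continuous (@norm2 R).
Proof.
move=> z; apply: continuous_comp; last exact: sqrt_continuous.
by apply: cvgD; apply: cvgM; (exact: cvg_fst || exact: cvg_snd).
Qed.

Lemma measurable_norm2 : measurable_fun setT (@norm2 R).
Proof.
apply: (@measurableT_comp _ _ _ _ _ _ (@Num.sqrt R)).
  by apply: continuous_measurable_fun; exact: sqrt_continuous.
by apply: measurable_funD; apply: measurable_funX;
  [exact: measurable_fst|exact: measurable_snd].
Qed.

Definition annulus s e : set (R * R) := [set z | `|norm2 z - s| <= e].

Lemma measurable_annulus s e : measurable (annulus s e).
Proof.
rewrite (_ : annulus s e = @norm2 R @^-1` `[s - e, s + e]).
  by rewrite -[X in measurable X]setTI; exact: measurable_norm2.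
apply/seteqP; split => z; rewrite /annulus/= in_itv/= ler_norml => /andP[? ?];
  apply/andP; lra.
Qed.

(* Restricting to the first quadrant keeps the relevant angles inside the
   domain [0, 2 pi] of the circular mean. *)
Definition qannulus a w : set (R * R) :=
  [set z | [/\ 0 <= z.1, 0 <= z.2 & a <= norm2 z <= a + w]].

Lemma measurable_qannulus a w : measurable (qannulus a w).
Proof.
rewrite (_ : qannulus a w =
    (`[0%R, +oo[ `*` `[0%R, +oo[) `&` (@norm2 R @^-1` `[a, a + w])).
  apply: measurableI; first by apply: measurableX.
  by rewrite -[X in measurable X]setTI; exact: measurable_norm2.
apply/seteqP; split => z; rewrite /qannulus/= !in_itv/= ?andbT.
  by move=> [].
by move=> [[]].
Qed.

Lemma leb2_sections_le (A : set (R * R)) (c M : R) : 0 <= M ->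
  (forall x, lebesgue_measure (xsection A x) <= c%:E)%E ->
  (forall x y, A (x, y) -> `|x| <= M) ->
  (leb2 A <= (2 * M * c)%:E)%E.
Proof.
move=> M0 Ac AM.
have c0 : 0 <= c by rewrite -lee_fin (le_trans (measure_ge0 _ _) (Ac 0)).
have -> : ((2 * M * c)%:E =
    \int[lebesgue_measure]_(x in `[(- M)%R, M]) (cst c%:E) x)%E.
  rewrite integral_cst//= lebesgue_measure_itv/= lte_fin.
  case: ltP => [_|h]; first by rewrite -EFinD -EFinM; congr EFin; ring.
  have -> : M = 0 by lra.
  by rewrite mule0 mulr0 mul0r.
rewrite integral_mkcond; apply: le_integral_nonneg => [x|x] /=.
  exact: measure_ge0.
rewrite patchE; case: ifPn => [_|xM]; first exact: Ac.
rewrite (_ : xsection A x = set0) ?measure0//.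
apply/seteqP; split => y //; rewrite /xsection/= inE => /AM.
by rewrite ler_norml => h; move: xM; rewrite notin_setE/= in_itv/= h.
Qed.

(** Integrating in either order gives a product measure, and the product measure is unique. *)
Lemma leb2_swap (A : set (R * R)) : measurable A ->
  leb2 A = leb2 [set z | A (z.2, z.1)].
Proof.
move=> mA; transitivity ((@lebesgue_measure R \x^ @lebesgue_measure R)%E A).
  apply: product_measure_unique => // B C mB mC.
  by rewrite /= product_measure2E.
by rewrite /leb2 /product_measure1 /product_measure2; congr integral.
Qed.

Lemma leb2_disc_le e : 0 <= e -> (leb2 (annulus 0 e) <= (4 * e ^+ 2)%:E)%E.
Proof.
move=> e0; have AB : annulus 0 e `<=` `[(- e)%R, e] `*` `[(- e)%R, e].
  move=> z; rewrite /annulus/= subr0 ger0_norm ?norm2_ge0// !in_itv/= => ze.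
  have := sqr_norm2 z; have := norm2_ge0 z => n0 n2.
  have h1 : z.1 ^+ 2 <= e ^+ 2 by nra.
  have h2 : z.2 ^+ 2 <= e ^+ 2 by nra.
  by split; apply/andP; split; nra.
apply: (le_trans (leb2_mono AB)).
rewrite /leb2 product_measure1E//= !lebesgue_measure_itv/= !lte_fin.
case: ltP => [_|h]; first by rewrite -EFinD -EFinM lee_fin; lra.
by rewrite mule0 lee_fin mulr_ge0// sqr_ge0.
Qed.

(* On the part of the annulus with |x| <= |y|, |y| is bounded below by 1/2, so
   that the vertical sections are made of two pieces of diameter O(e). *)
Lemma leb2_annulus_sector_le s e : 1 <= s - e -> s + e <= 7 -> 0 <= e ->
  (leb2 (annulus s e `&` [set z : R * R | `|z.1| <= `|z.2|]%R) <=
    (1568 * e)%:E)%E.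
Proof.
move=> s1 s7 e0; rewrite (_ : 1568 * e = 2 * 7 * (112 * e)); last by ring.
have V z : annulus s e z -> `|z.1| <= `|z.2| ->
    [/\ 1 <= z.1 ^+ 2 + z.2 ^+ 2, (s - e) ^+ 2 <= z.1 ^+ 2 + z.2 ^+ 2,
        z.1 ^+ 2 + z.2 ^+ 2 <= (s + e) ^+ 2 & 1 <= 2 * `|z.2|].
  rewrite /annulus/= ler_norml => /andP[h1 h2] z12.
  have := sqr_norm2 z; have n0 := norm2_ge0 z => n2.
  have n1 : 1 <= z.1 ^+ 2 + z.2 ^+ 2 by nra.
  split => //; [nra|nra|].
  have := real_normK (num_real z.1); have := real_normK (num_real z.2).
  have := normr_ge0 z.1; have := normr_ge0 z.2; nra.
apply: leb2_sections_le => // [x|x y []]; last first.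
  move=> /V h /= xy; have [_ _ /= h3 _] := h xy.
  have := real_normK (num_real x); have := normr_ge0 x.
  have := sqr_ge0 y; nra.
set S := xsection _ x.
have SE y : S y -> annulus s e (x, y) /\ `|x| <= `|y|.
  by rewrite /S /xsection/= inE.
have [->|/set0P[y0 Sy0]] := eqVneq S set0.
  by rewrite measure0 lee_fin; lra.
have {}Sy0 := SE _ Sy0; have [_ h1 h2 h3] := V _ Sy0.1 Sy0.2.
move: h1 h2 h3 => /= h1 h2 h3.
apply: (@le_trans _ _ (lebesgue_measure (
   (`[`|y0| - 28 * e, `|y0| + 28 * e] : set R) `|`
   `[- `|y0| - 28 * e, - `|y0| + 28 * e]))).
  apply: lebesgue_measure_mono => y /SE[A xy].
  have [_ k1 k2 k3] := V _ A xy; move: k1 k2 k3 => /= k1 k2 k3.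
  (* For fixed [x], the squares of [y] and [y0] differ by at most [4 * s * e <= 28 * e], and the sum
     of their absolute values is at least 1. *)
  have h : `|y| - `|y0| <= 28 * e /\ `|y0| - `|y| <= 28 * e.
    have := real_normK (num_real y); have := real_normK (num_real y0).
    have e1 : (s + e) ^+ 2 - (s - e) ^+ 2 <= 28 * e.
      have -> : (s + e) ^+ 2 - (s - e) ^+ 2 = 4 * s * e by ring.
      nra.
    move=> q0 q; split; nra.
  have [y_ge0|y_lt0] := leP 0 y.
    by left; rewrite /= in_itv/= -{1 2}(ger0_norm y_ge0); apply/andP; lra.
  right; rewrite /= in_itv/= -[X in _ <= X <= _]opprK -(ltr0_norm y_lt0).
  by apply/andP; lra.
apply: le_trans (measureU2 _ _ _) _ => //.
rewrite /= !lebesgue_measure_itv/= !lte_fin; do 2!case: ltP => _;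
  by rewrite -?EFinD ?adde0 ?add0e -?EFinD lee_fin; lra.
Qed.

(** The sector treated above and its reflection in the diagonal cover the annulus and have equal
    area. *)
Lemma leb2_annulus_le s e : 1 <= s - e -> s + e <= 7 -> 0 <= e ->
  (leb2 (annulus s e) <= (3136 * e)%:E)%E.
Proof.
move=> s1 s7 e0.
pose V : set (R * R) := annulus s e `&` [set z : R * R | `|z.1| <= `|z.2|].
have mV : measurable V.
  rewrite /V -[X in _ `&` X]setTI.
  apply: measurableI; first exact: measurable_annulus.
  by apply: measurable_fun_le => //; apply: measurableT_comp.
pose H : set (R * R) := [set z | V (z.2, z.1)].
have mH : measurable H.
  rewrite (_ : H = (fun z => (z.2, z.1)) @^-1` V)// -[X in measurable X]setTI.
  by apply: (measurable_fun_pair measurable_snd measurable_fst).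
have VH : annulus s e `<=` V `|` H.
  move=> z; rewrite /V /H /annulus/= /norm2/= => zA.
  have [h|h] := leP `|z.1| `|z.2|; first by left.
  right; split => /=; last exact: ltW.
  by rewrite /annulus /norm2/= [X in Num.sqrt X]addrC.
apply: (le_trans (leb2_mono VH)).
have h := @measureU2 _ _ _ (@leb2 R) _ _ mV mH.
apply: (le_trans h); rewrite (_ : 3136 * e = 1568 * e + 1568 * e); last by lra.
have HV : leb2 H = leb2 V by exact/esym/leb2_swap.
rewrite EFinD; apply: leeD; first exact: leb2_annulus_sector_le.
by have := leb2_annulus_sector_le s1 s7 e0; rewrite -/V -HV.
Qed.

(** For each abscissa in [[0, a]], raising the point of the circle of radius [a] by at most [w]
    raises its norm by at most [w], so the section contains an interval of length [w]. *)
Lemma leb2_qannulus_ge a w : 0 <= a -> 0 <= w ->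
  ((a * w)%:E <= leb2 (qannulus a w))%E.
Proof.
move=> a0 w0.
have -> : ((a * w)%:E = \int[lebesgue_measure]_(x in `[0%R, a]) (cst w%:E) x)%E.
  rewrite integral_cst//= lebesgue_measure_itv/= lte_fin.
  case: ltP => [_|h]; first by rewrite -EFinD -EFinM; congr EFin; ring.
  have -> : a = 0 by lra.
  by rewrite mule0 mul0r.
rewrite integral_mkcond; apply: le_integral_nonneg => [x|x] /=.
  by rewrite patchE; case: ifPn => //=; rewrite lee_fin.
rewrite patchE; case: ifPn => [|_]; last exact: measure_ge0.
rewrite inE/= in_itv/= => /andP[x0 xa].
set c := Num.sqrt (a ^+ 2 - x ^+ 2).
have c0 : 0 <= c by exact: sqrtr_ge0.
have c2 : c ^+ 2 = a ^+ 2 - x ^+ 2 by rewrite sqr_sqrtr//; nra.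
have ca : c <= a by nra.
apply: (@le_trans _ _ (lebesgue_measure (`[c, c + w] : set R))).
  rewrite lebesgue_measure_itv/= lte_fin; case: ltP => [_|h].
    by rewrite -EFinD lee_fin; lra.
  by rewrite lee_fin; lra.
apply: lebesgue_measure_mono => y.
rewrite /xsection/= in_itv/= inE => /andP[cy yc].
have := sqr_norm2 (x, y); have := norm2_ge0 (x, y) => /= n0 n2.
split => //=; first lra.
by apply/andP; split; nra.
Qed.

(** Separation of the radii makes the quarter annuli disjoint, so their areas add up. *)
Lemma leb2_bigcup_qannulus_ge k (a : nat -> R) m w : 0 <= m -> 0 <= w ->
  (forall i, (i < k)%N -> m <= a i) ->
  (forall i j, (i < j < k)%N -> w < `|a i - a j|) ->
  ((k%:R * (m * w))%:E <= leb2 (\bigcup_(i in `I_k) qannulus (a i) w))%E.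
Proof.
move=> m0 w0 ma sep.
rewrite /leb2 measure_fin_bigcup/=; last 3 first.
- exact: finite_II.
- move=> i j /= ik jk [z [[_ _ /andP[h1 h2]] [_ _ /andP[h3 h4]]]].
  apply: contrapT => /eqP; rewrite neq_ltn => /orP[] ij.
    have := sep i j; rewrite ij jk => /(_ isT).
    by rewrite ltr_normr => /orP[]; lra.
  have := sep j i; rewrite ij ik => /(_ isT).
  by rewrite ltr_normr => /orP[]; lra.
- by move=> i _; exact: measurable_qannulus.
rewrite -(@fsbig_ord _ _ _ _ (fun i => leb2 (qannulus (a i) w))).
apply: (@le_trans _ _ (\sum_(i < k) (m * w)%:E)%E).
  by rewrite sumEFin lee_fin sumr_const card_ord mulr_natl.
apply: lee_sum => i _; apply: le_trans (leb2_qannulus_ge _ w0); last first.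
  exact: le_trans m0 (ma _ _).
by rewrite lee_fin ler_wpM2r// ma.
Qed.

End PlaneMeasure.

(** * Lower bounds for circular means of the test functions *)

Section Averages.
Context {R : realType}.
Implicit Types (t s e : R) (x z : R * R) (f : R * R -> R).

(** A continuous substitute for an indicator, as [Cc] demands: for [e > 0] it is 1 on [annulus s e]
    and 0 off [annulus s (2 * e)]. *)
Definition bump s e z : R := Num.max 0 (Num.min 1 (2 - `|norm2 z - s| / e)).

Lemma bump01 s e z : 0 <= bump s e z <= 1.
Proof. by rewrite /bump le_max lexx/= ge_max ler01/= ge_min lexx. Qed.

Lemma bump_eq1 s e z : 0 < e -> `|norm2 z - s| <= e -> bump s e z = 1.
Proof.
move=> e0 h; have h1 : `|norm2 z - s| / e <= 1 by rewrite ler_pdivrMr// mul1r.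
rewrite /bump min_l; last by lra.
by rewrite max_r.
Qed.

Lemma bump_supp s e z : 0 < e -> bump s e z != 0 -> annulus s (2 * e) z.
Proof.
move=> e0; apply: contraNP; rewrite /annulus/= => /negP; rewrite -ltNge => h.
have h1 : 2 < `|norm2 z - s| / e by rewrite ltr_pdivlMr.
apply/eqP; rewrite /bump max_l// ge_min; apply/orP; right; lra.
Qed.

Lemma radial_bump s e : radial (bump s e).
Proof. by move=> z w zw; rewrite /bump zw. Qed.

Lemma Cc_bump s e : 0 < e -> Cc (bump s e).
Proof.
move=> e0; split.
  have cg : continuous (fun z => 2 - `|norm2 z - s| / e : R^o).
    move=> z; apply: cvgB; first exact: cvg_cst.
    apply: cvgM; last exact: cvg_cst.
    apply: cvg_norm; apply: cvgB; [exact: continuous_norm2|exact: cvg_cst].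
  move=> z; apply: (@continuous_max R (R * R)%type (cst 0)
    (cst 1 \min (fun z => 2 - `|norm2 z - s| / e))); first exact: cvg_cst.
  by apply: continuous_min; [exact: cvg_cst|exact: cg].
exists (s + 2 * e) => z h; apply: contrapT => /eqP /(bump_supp e0).
rewrite /annulus/= ler_norml; lra.
Qed.

Lemma circavg_ge f x (t a eta : R) : continuous f -> (forall z, 0 <= f z) ->
  0 <= a -> 0 <= eta -> a + eta <= 2 * pi ->
  (forall th, a <= th <= a + eta ->
     1 <= f (x.1 - t * cos th, x.2 - t * sin th)) ->
  eta / (2 * pi) <= circavg f x t.
Proof.
move=> cf f0 a0 eta0 aeta f1; rewrite /circavg mulrC.
have pi0 := @pi_gt0 R.
rewrite ler_pM2l ?invr_gt0 ?mulr_gt0//.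
set g := fun th => f (x.1 - t * cos th, x.2 - t * sin th).
have cg : continuous g.
  move=> th; apply: (@continuous_comp _ _ _
    (fun th => (x.1 - t * cos th, x.2 - t * sin th)) f); last exact: cf.
  have c1 : (fun th => x.1 - t * cos th) @ th --> x.1 - t * cos th.
    apply: cvgB; first exact: cvg_cst.
    by apply: cvgM; [exact: cvg_cst|exact: continuous_cos].
  have c2 : (fun th => x.2 - t * sin th) @ th --> x.2 - t * sin th.
    apply: cvgB; first exact: cvg_cst.
    by apply: cvgM; [exact: cvg_cst|exact: continuous_sin].
  exact: (cvg_pair c1 c2).
have -> : [set th : R | 0 <= th <= 2 * pi] = `[0, 2 * pi]%classic.
  by apply/seteqP; split => th; rewrite /= in_itv.
have ig : lebesgue_measure.-integrable `[0, 2 * pi] (EFin \o g).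
  apply: continuous_compact_integrable; first exact: segment_compact.
  exact: continuous_subspaceT.
rewrite /Rintegral -lee_fin fineK; last exact: integrable_fin_num.
have -> : (eta%:E =
    \int[lebesgue_measure]_(y in `[a, (a + eta)%R]) (cst 1%:E) y)%E.
  rewrite integral_cst//= lebesgue_measure_itv/= lte_fin.
  case: ltP => [_|h]; first by rewrite -EFinD mul1e; congr EFin; ring.
  have -> : eta = 0 by lra.
  by rewrite mule0.

rewrite [leLHS]integral_mkcond [leRHS]integral_mkcond.
apply: le_integral_nonneg => [y|y] /=; rewrite !patchE.
  by case: ifPn => //=; rewrite lee_fin.
case: ifPn => [|_]; last first.
  by case: ifPn => // _ /=; rewrite lee_fin; exact: f0.
rewrite inE/= in_itv/= => /[dup] /f1 gy /andP[h1 h2].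
rewrite mem_set/=; first by rewrite lee_fin.
by rewrite in_itv/=; apply/andP; lra.
Qed.

Lemma maxE_ge (E : set R) f x t lam : E t -> lam <= circavg f x t ->
  (lam%:E <= `|maxE E f x|)%E.
Proof.
move=> Et h; apply: le_trans (lee_abs _); apply: le_ereal_sup_tmp.
exists `|circavg f x t|%:E; first by exists t.
by rewrite lee_fin (le_trans h)// ler_norm.
Qed.

(** By the half-angle formula [1 - cos y] is twice the square of [sin (y / 2)], which the mean value
    theorem bounds by [y / 2]. *)
Lemma cos_ge_quadratic (y : R) : 0 <= y -> 1 - y ^+ 2 / 2 <= cos y.
Proof.
move=> y0; have y20 : 0 <= y / 2 by lra.
have [c _] := @MVT_segment _ (@sin R) (@cos R) 0 (y / 2) y20
  (fun u _ => is_derive_sin u) (continuous_subspaceT (@continuous_sin R)).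
rewrite sin0 !subr0; set w := y / 2 => sE.
have -> : y = w *+ 2 by rewrite /w -mulr_natl; lra.
clearbody w.
have -> : cos (w *+ 2) = 1 - 2 * (cos c * w) ^+ 2.
  by rewrite cos_mulr2n cos2sin2 sE mulr2n; ring.
rewrite -(mulr_natl w) !exprMn.
have := cos2Dsin2 c; have := sqr_ge0 (sin c); set C := cos c => h1 h2.
have : C ^+ 2 * w ^+ 2 <= 1 * w ^+ 2.
  by rewrite ler_wpM2r ?sqr_ge0//; lra.
by lra.
Qed.

(** A polar angle of at most [pi / 2] leaves room in [[0, 2 pi]] for short arcs starting at [phi] or
    at [phi + pi]. *)
Lemma quadrant_polar z : 0 <= z.1 -> 0 <= z.2 ->
  exists2 phi, 0 <= phi <= pi / 2 &
    z.1 = norm2 z * cos phi /\ z.2 = norm2 z * sin phi.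
Proof.
move=> z1 z2; have := sqr_norm2 z; have n0 := norm2_ge0 z => n2.
have pi0 := @pi_gt0 R.
have [nz|nz] := eqVneq (norm2 z) 0.
  exists 0; first by apply/andP; lra.
  by move: n2; rewrite nz expr0n/= !mul0r => n2; split; nra.
have np : 0 < norm2 z by rewrite lt_neqAle eq_sym nz.
have y01 : -1 <= z.1 / norm2 z <= 1.
  apply/andP; split; first by rewrite (le_trans (lerN10 _))// divr_ge0.
  by rewrite ler_pdivrMr// mul1r; nra.
have c : cos (acos (z.1 / norm2 z)) = z.1 / norm2 z by rewrite acosK// in_itv.
exists (acos (z.1 / norm2 z)).
  rewrite acos_ge0//= leNgt; apply/negP => lt.
  have : cos (acos (z.1 / norm2 z)) < cos (pi / 2).
    have i1 : acos (z.1 / norm2 z) \in `[0, pi].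
      by rewrite in_itv/= acos_ge0// acos_lepi.
    have i2 : pi / 2 \in `[0, (pi : R)] by rewrite in_itv/=; apply/andP; lra.
    by rewrite (ltr_cos i2 i1).
  by rewrite cos_pihalf c; apply/negP; rewrite -leNgt divr_ge0.
rewrite c; split; first by rewrite mulrC divfK.
have e : 1 - (z.1 / norm2 z) ^+ 2 = (z.2 / norm2 z) ^+ 2.
  transitivity ((norm2 z ^+ 2 - z.1 ^+ 2) / norm2 z ^+ 2); first by field.
  have -> : norm2 z ^+ 2 - z.1 ^+ 2 = z.2 ^+ 2 by rewrite n2; ring.
  by field.
by rewrite sin_acos// e sqrtr_sqr ger0_norm ?divr_ge0// mulrC divfK.
Qed.

(** The law of cosines. *)
Lemma sqr_norm2_circle (rho phi t th : R) :
  norm2 (rho * cos phi - t * cos th, rho * sin phi - t * sin th) ^+ 2 =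
  rho ^+ 2 + t ^+ 2 - 2 * rho * t * cos (th - phi).
Proof.
rewrite sqr_norm2/= cosB.
have := cos2Dsin2 phi; have := cos2Dsin2 th => h1 h2.
transitivity (rho ^+ 2 * (cos phi ^+ 2 + sin phi ^+ 2)
  + t ^+ 2 * (cos th ^+ 2 + sin th ^+ 2)
  - 2 * rho * t * (cos th * cos phi + sin th * sin phi)); first by ring.
by rewrite h1 h2 !mulr1.
Qed.

(** For directions within [e / 2] of that of [x], the circle passes within [2 * e] of the origin:
    the radial gap contributes at most [e ^+ 2] to the squared norm, the angular one at most
    [12 * e ^+ 2 / 8]. *)
Lemma circavg_inner_ge x t e : 0 <= x.1 -> 0 <= x.2 -> 1 <= t <= 2 ->
  0 < e <= 1 -> t <= norm2 x <= t + e ->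
  (e / 2) / (2 * pi) <= circavg (bump 0 (2 * e)) x t.
Proof.
move=> x1 x2 /andP[t1 t2] /andP[e0 e1] /andP[n1 n2].
have [phi /andP[p0 p1] [xc xs]] := quadrant_polar x1 x2.
have pi2 := @pi_ge2 R; have e20 : 0 < 2 * e by lra.
apply: (@circavg_ge _ _ _ phi) => //; try lra.
- by case: (Cc_bump 0 e20).
- by move=> z; case/andP: (bump01 0 (2 * e) z).
move=> th /andP[th1 th2]; rewrite bump_eq1// subr0 ger0_norm ?norm2_ge0//.
rewrite xc xs -ler_sqr ?nnegrE ?norm2_ge0 ?(ltW e20)// sqr_norm2_circle.
have y0 : 0 <= th - phi by lra.
have := cos_ge_quadratic y0; set c := cos _ => hc.
have y2 : (th - phi) ^+ 2 <= e ^+ 2 / 4 by nra.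
have h : 1 - e ^+ 2 / 8 <= c by lra.
have rt0 : 0 <= norm2 x * t by nra.
have rt6 : norm2 x * t <= 6 by nra.
have : norm2 x * t * (1 - e ^+ 2 / 8) <= norm2 x * t * c.
  by rewrite ler_wpM2l.
nra.
Qed.

(** The arc starts at [phi + pi], where the circle is farthest from the origin, at norm
    [norm2 x + t] between [s] and [s + e]. Over an angle [q / 2] the squared norm drops by at most
    [norm2 x * t * q ^+ 2 / 4 <= t * e], hence the norm by at most [e]. *)
Lemma circavg_outer_ge x t s e r : 0 <= x.1 -> 0 <= x.2 -> 1 <= t ->
  0 < e <= r -> 2 * r <= norm2 x <= 4 * r ->
  s - t <= norm2 x <= s - t + e ->
  (Num.sqrt (e / r) / 2) / (2 * pi) <= circavg (bump s e) x t.
Proof.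
move=> x1 x2 t1 /andP[e0 er] /andP[n1 n2] /andP[n3 n4].
have [phi /andP[p0 p1] [xc xs]] := quadrant_polar x1 x2.
have pi2 := @pi_ge2 R; have r0 : 0 < r by lra.
set q := Num.sqrt (e / r).
have q0 : 0 <= q by exact: sqrtr_ge0.
have q2 : q ^+ 2 = e / r by rewrite sqr_sqrtr// divr_ge0// ltW.
have q1 : q <= 1.
  by rewrite -ler_sqr ?nnegrE// q2 expr1n ler_pdivrMr// mul1r.
have q2r : q ^+ 2 * r = e by rewrite q2 divfK// gt_eqF.
apply: (@circavg_ge _ _ _ (phi + pi)) => //; try lra.
- by case: (Cc_bump s e0).
- by move=> z; case/andP: (bump01 s e z).
move=> th /andP[th1 th2]; rewrite bump_eq1//.
rewrite xc xs; set n := norm2 (_, _).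
have n0 : 0 <= n by exact: norm2_ge0.
have nE : n ^+ 2 =
    norm2 x ^+ 2 + t ^+ 2 + 2 * norm2 x * t * cos (th - (phi + pi)).
  rewrite sqr_norm2_circle (_ : th - phi = th - (phi + pi) + pi); last by ring.
  by rewrite cosDpi; ring.
have y0 : 0 <= th - (phi + pi) by lra.
have := cos_ge_quadratic y0.
have := cos_le1 (th - (phi + pi)); move: nE; set c := cos _ => nE c1 hc.
have y2 : (th - (phi + pi)) ^+ 2 <= q ^+ 2 / 4 by nra.
have h : 1 - q ^+ 2 / 8 <= c by lra.
have rt0 : 0 <= norm2 x * t by nra.
have k1 : norm2 x * t * (1 - q ^+ 2 / 8) <= norm2 x * t * c.
  by rewrite ler_wpM2l.
have k2 : norm2 x * t * c <= norm2 x * t * 1 by rewrite ler_wpM2l.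
have k3 : norm2 x * t * q ^+ 2 <= 4 * t * e.
  rewrite -q2r (_ : 4 * t * (q ^+ 2 * r) = (4 * r * t) * q ^+ 2); last by ring.
  by rewrite ler_wpM2r ?sqr_ge0// ler_wpM2r//; lra.
have u : n <= norm2 x + t by rewrite -ler_sqr ?nnegrE//; [nra|lra].
have l : norm2 x + t - e <= n by rewrite -ler_sqr ?nnegrE//; [nra|lra].
rewrite ler_norml; lra.
Qed.

(** The whole circle stays in the disc of radius [e + 2 <= 2 * e]; an arc of length 1 already gives
    the constant. *)
Lemma circavg_disc_ge x t e : 0 <= x.1 -> 0 <= x.2 -> 0 <= t <= 2 ->
  2 <= e -> norm2 x <= e ->
  1 / (2 * pi) <= circavg (bump 0 (2 * e)) x t.
Proof.
move=> x1 x2 /andP[t1 t2] e2 n.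
have [phi /andP[p0 p1] [xc xs]] := quadrant_polar x1 x2.
have pi2 := @pi_ge2 R; have e20 : 0 < 2 * e by lra.
have n0 := norm2_ge0 x.
apply: (@circavg_ge _ _ _ phi) => //; try lra.
- by case: (Cc_bump 0 e20).
- by move=> z; case/andP: (bump01 0 (2 * e) z).
move=> th _; rewrite bump_eq1// subr0 ger0_norm ?norm2_ge0//.
rewrite xc xs -ler_sqr ?nnegrE ?norm2_ge0 ?(ltW e20)// sqr_norm2_circle.
have hc := cos_geN1 (th - phi).
have rt0 : 0 <= norm2 x * t by nra.
have : norm2 x * t * -1 <= norm2 x * t * cos (th - phi) by rewrite ler_wpM2l.
nra.
Qed.

End Averages.

(** * Testing the bounds on discs and annuli *)

Section Testing.
Context {R : realType}.
Implicit Types (E : set R) (u v : R).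

(* The part of an L^p -> L^q bound, of strong or of restricted weak type, that
   is seen by the functions bump s e. *)
Definition tested E u v : Prop := exists2 C : R, 0 <= C &
  forall (s e lam a b : R) (B : set (R * R)), 0 < e -> 0 < lam -> 0 < b ->
    measurable B -> (b%:E <= leb2 B)%E ->
    (leb2 (annulus s (2 * e)%R) <= a%:E)%E ->
    (forall z, B z -> exists2 t, E t & lam <= circavg (bump s e) z t) ->
    lam * b `^ v <= C * a `^ u.

Lemma le_poweR_fin (x y : \bar R) (r : R) : 0 <= r -> (0 <= x)%E ->
  (x <= y)%E -> (x `^ r <= y `^ r)%E.
Proof.
move=> r0 x0 xy; apply: gt0_ler_poweR; rewrite ?in_itv/= ?leey ?andbT//.
exact: le_trans xy.
Qed.

(** The constant is made nonnegative so that the area of the annulus can be replaced by any upper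
    bound [a]. *)
Lemma tested_of_le E u v : 0 <= u -> 0 <= v ->
  (exists C : R, forall (s e lam : R) (B : set (R * R)), 0 < e -> 0 < lam ->
     measurable B -> (0 < leb2 B)%E ->
     (forall z, B z -> (lam%:E <= `|maxE E (bump s e) z|)%E) ->
     (lam%:E * leb2 B `^ v <= C%:E * leb2 (annulus s (2 * e)%R) `^ u)%E) ->
  tested E u v.
Proof.
move=> u0 v0 [C hC]; exists (Num.max C 0); first by rewrite le_max lexx orbT.
move=> s e lam a b B e0 l0 b0 mB bB Aa BE.
have A0 : (0 <= leb2 (annulus s (2 * e)%R))%E by exact: measure_ge0.
have : (lam%:E * leb2 B `^ v <= C%:E * leb2 (annulus s (2 * e)%R) `^ u)%E.
  apply: hC => //; first by rewrite (lt_le_trans _ bB)// lte_fin.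
  by move=> z /BE [t Et]; exact: maxE_ge.
move=> h; rewrite -lee_fin !EFinM -!poweR_EFin.
apply: (@le_trans _ _ (lam%:E * leb2 B `^ v)%E).
  apply: lee_wpmul2l; first by rewrite lee_fin ltW.
  by apply: le_poweR_fin => //; rewrite lee_fin ltW.
apply: (le_trans h).
apply: (@le_trans _ _ ((Num.max C 0)%:E * leb2 (annulus s (2 * e)%R) `^ u)%E).
  by apply: lee_wpmul2r; [exact: poweR_ge0|rewrite lee_fin le_max lexx].
by apply: lee_wpmul2l; [rewrite lee_fin le_max lexx orbT|exact: le_poweR_fin].
Qed.

Lemma tested_of_rad_bounded E u v : 0 <= u -> 0 <= v ->
  rad_bounded E u v -> tested E u v.
Proof.
move=> u0 v0 [C hC]; apply: tested_of_le => //; exists (Num.max C 0).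
move=> s e lam B e0 l0 mB B0 BE.
have h0 := Lnorm_ge_measure (mu := @leb2 R) v0 (ltW l0) mB B0 BE.
apply: (le_trans h0).
apply: (le_trans (hC _ (@radial_bump _ s e) (Cc_bump s e0))).
have h := Lnorm_le_measure (@leb2 R) u0 (measurable_annulus s (2 * e))
  (bump01 s e) (fun z => @bump_supp _ s e z e0).
apply: (@le_trans _ _ ((Num.max C 0)%:E *
  Lnorm (@leb2 R) (expo u) (EFin \o bump s e))%E).
  by apply: lee_wpmul2r; [exact: Lnorm_ge0|rewrite lee_fin le_max lexx].
by apply: lee_wpmul2l => //; rewrite lee_fin le_max lexx orbT.
Qed.

Lemma tested_of_rad_restricted_weak E p : 1 <= p ->
  rad_restricted_weak E p (2 * p) -> tested E p^-1 (2 * p)^-1.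
Proof.
move=> p1 [C hC]; have p0 : 0 < p by lra.
apply: tested_of_le; rewrite ?invr_ge0; try lra.
(* The 2 undoes the halved level in [weakL_ge_measure]; [p] is the normalisation in [lorentz1]. *)
exists (2 * (Num.max C 0 * p)) => s e lam B e0 l0 mB B0 BE.
have q0 : 0 < 2 * p by lra.
have h1 := weakL_ge_measure q0 l0 BE.
have h2 := lorentz1_le_measure p1 (bump01 s e) (fun z => @bump_supp _ s e z e0).
have h3 := hC _ (@radial_bump _ s e) (Cc_bump s e0).
have -> : lam = 2 * (lam / 2) by lra.
rewrite (EFinM 2 (lam / 2)) (EFinM 2 (Num.max C 0 * p)) -!muleA.
apply: lee_wpmul2l; first by rewrite lee_fin.
apply: (le_trans h1); apply: (le_trans h3).
apply: (@le_trans _ _ ((Num.max C 0)%:E * lorentz1 p (bump s e))%E).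
  apply: lee_wpmul2r; last by rewrite lee_fin le_max lexx.
  rewrite /lorentz1 mule_ge0 ?lee_fin ?(ltW p0)// integral_ge0// => x _.
  exact: poweR_ge0.
rewrite EFinM -muleA; apply: lee_wpmul2l => //.
by rewrite lee_fin le_max lexx orbT.
Qed.

Lemma qannuli_measurable k (a : nat -> R) w :
  measurable (\bigcup_(i in `I_k) qannulus (a i) w).
Proof.
apply: fin_bigcup_measurable; first exact: finite_II.
by move=> i _; exact: measurable_qannulus.
Qed.

(** The test function is [bump 0 (2 * e)], supported in a disc of radius [4 * e] and area at most
    [64 * e ^+ 2]. By [circavg_inner_ge] its maximal function is large on the disjoint quarter
    annuli just outside the radii [a i]. *)
Lemma tested_disc E u v : E `<=` [set t | 1 <= t <= 2] -> tested E u v ->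
  exists2 C : R, 0 <= C & forall (e : R) k (a : nat -> R), 0 < e <= 1 ->
    (0 < k)%N -> (forall i, (i < k)%N -> E (a i)) ->
    (forall i j, (i < j < k)%N -> e < `|a i - a j|) ->
    e * (k%:R * e) `^ v <= C * e `^ (2 * u).
Proof.
move=> E12 [C C0 hC]; have pi0 := @pi_gt0 R.
exists (4 * pi * C * 64 `^ u); first by rewrite !mulr_ge0 ?powR_ge0// ltW.
move=> e k a /andP[e0 e1] k0 Ea sep.
have lam0 : 0 < e / 2 / (2 * pi) by rewrite !divr_gt0// mulr_gt0.
have k0' : 0 < k%:R :> R by rewrite ltr0n.
have e20 : 0 < 2 * e by lra.
have := hC 0 (2 * e) (e / 2 / (2 * pi)) (64 * e ^+ 2) (k%:R * e)
  (\bigcup_(i in `I_k) qannulus (a i) e) e20 lam0 (mulr_gt0 k0' e0)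
  (qannuli_measurable _ _ _).
have bB : ((k%:R * e)%:E <= leb2 (\bigcup_(i in `I_k) qannulus (a i) e))%E.
  have := @leb2_bigcup_qannulus_ge _ k a 1 e; rewrite mul1r; apply => //.
  - exact: ltW.
  - by move=> i /Ea/E12/andP[].
have Aa : (leb2 (annulus 0%R (2 * (2 * e))%R) <= (64 * e ^+ 2)%:E)%E.
  apply: le_trans (leb2_disc_le _) _; first by lra.
  by rewrite lee_fin; lra.
move=> /(_ bB Aa) h.
have {}h : e / 2 / (2 * pi) * (k%:R * e) `^ v <= C * (64 * e ^+ 2) `^ u.
  apply: h => z [i /= ik [z1 z2 nz]]; exists (a i); first exact: Ea.
  by apply: circavg_inner_ge => //; [exact/E12/Ea|rewrite e0].
have -> : e `^ (2 * u) = (e ^+ 2) `^ u by rewrite powRrM powR_mulrn// ltW.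
rewrite -mulrA -powRM ?sqr_ge0// -mulrA.
rewrite (_ : e * _ = 4 * pi * (e / 2 / (2 * pi) * (k%:R * e) `^ v)).
  by rewrite ler_pM2l// mulr_gt0.
have pin : pi != 0 :> R by rewrite gt_eqF.
by move: pin; generalize (pi : R) => c cn; field.
Qed.

(* At a point of norm ~ r, a circle internally tangent to the annulus of
   thickness e stays in it for an angle of size (e / r) ^ (1/2). *)
Lemma tested_annulus E u v : E `<=` [set t | 1 <= t <= 2] -> tested E u v ->
  exists2 C : R, 0 <= C & forall (e r x : R) k (a : nat -> R), 0 < e <= r ->
    r <= 1 -> (0 < k)%N -> (forall i, (i < k)%N -> (E `&` ival x r) (a i)) ->
    (forall i j, (i < j < k)%N -> e < `|a i - a j|) ->
    (e / r) `^ 2^-1 * (k%:R * (r * e)) `^ v <= C * e `^ u.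
Proof.
move=> E12 [C C0 hC]; have pi0 := @pi_gt0 R.
have [K K0 AK] : exists2 K : R, 0 <= K & forall s e : R, 1 <= s - 2 * e ->
    s + 2 * e <= 7 -> 0 <= e -> (leb2 (annulus s (2 * e)%R) <= (K * e)%:E)%E.
  exists (3136 * 2); first lra.
  move=> s e h1 h2 e0; rewrite -mulrA; apply: leb2_annulus_le; lra.
exists (4 * pi * C * K `^ u).
  by rewrite !mulr_ge0 ?powR_ge0// ltW.
move=> e r x k a /andP[e0 er] r1 k0 Ea sep.
have r0 : 0 < r by lra.
have er0 : 0 < e / r by rewrite divr_gt0.
rewrite (powR12_sqrt (ltW er0)); set q := Num.sqrt (e / r).
have q0 : 0 < q by rewrite sqrtr_gt0.
have lam0 : 0 < q / 2 / (2 * pi) by rewrite !divr_gt0// mulr_gt0.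
have k0' : 0 < k%:R :> R by rewrite ltr0n.
have b0 : 0 < k%:R * (r * e) by rewrite !mulr_gt0.
(* With this radius each [s - a i] lies between [2 * r] and [3 * r], so the quarter annuli of width
   [e <= r] have norms between [2 * r] and [4 * r]. *)
pose s := x + 3 * r.
have aP i : (i < k)%N -> [/\ 1 <= a i, a i <= 2, x <= a i & a i <= x + r].
  by move=> /Ea [/E12/andP[? ?] /andP[? ?]].
have := hC s e (q / 2 / (2 * pi)) (K * e) (k%:R * (r * e))
  (\bigcup_(i in `I_k) qannulus (s - a i) e) e0 lam0 b0
  (qannuli_measurable _ _ _).
have bB : ((k%:R * (r * e))%:E <=
    leb2 (\bigcup_(i in `I_k) qannulus (s - a i)%R e))%E.
  apply: leb2_bigcup_qannulus_ge => //; try lra.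
  - by move=> i /aP[]; rewrite /s; lra.
  - move=> i j ij; rewrite (_ : _ - _ = - (a i - a j)); last by ring.
    by rewrite normrN; exact: sep.
have Aa : (leb2 (annulus s (2 * e)%R) <= (K * e)%:E)%E.
  have [h1 h2 h3 h4] := aP _ k0.
  by apply: AK; rewrite /s; lra.
move=> /(_ bB Aa) h.
have {}h : q / 2 / (2 * pi) * (k%:R * (r * e)) `^ v <= C * (K * e) `^ u.
  apply: h => z [i /= ik [z1 z2 /andP[n1 n2]]].
  have [h1 h2 h3 h4] := aP _ ik.
  exists (a i); first by have [] := Ea _ ik.
  rewrite /s in n1 n2 *.
  apply: circavg_outer_ge => //; first by rewrite e0.
    by apply/andP; lra.
  by rewrite n1.
have -> : 4 * pi * C * K `^ u * e `^ u = 4 * pi * (C * (K * e) `^ u).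
  by rewrite (powRM _ K0 (ltW e0)) !mulrA.
have -> : q * (k%:R * (r * e)) `^ v =
    4 * pi * (q / 2 / (2 * pi) * (k%:R * (r * e)) `^ v).
  have pin : pi != 0 :> R by rewrite gt_eqF.
  by move: pin; generalize (pi : R) => c cn; field.
by rewrite ler_pM2l// mulr_gt0.
Qed.

Lemma exponent_le (c C x y : R) : 0 < c ->
  (forall e, 0 < e < 1 -> c * e `^ x <= C * e `^ y) -> y <= x.
Proof.
move=> c0 h; rewrite leNgt; apply/negP => xy.
have C0 : 0 < C.
  have := h 2^-1; rewrite invr_gt0 invf_lt1 ?ltr1n// ltr0n => /(_ isT) h1.
  have p1 : 0 < (2^-1 : R) `^ x by rewrite powR_gt0.
  have p2 : 0 < (2^-1 : R) `^ y by rewrite powR_gt0.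
  rewrite -(pmulr_lgt0 _ p2); apply: lt_le_trans h1; exact: mulr_gt0.
(* If [x < y], the choice of [e] below makes [e] to the power [x - y] equal to [M], and [c * M]
   exceeds [C]. *)
set M := C / c + 1.
have M1 : 1 < M by rewrite /M ltrDr divr_gt0.
have M0 : 0 < M by lra.
set e := M `^ (x - y)^-1.
have e0 : 0 < e by rewrite powR_gt0.
have d0 : (x - y)^-1 < 0 by rewrite invr_lt0; lra.
have e1 : e < 1.
  have -> : e = (M `^ - (x - y)^-1)^-1 by rewrite powRN invrK.
  rewrite invf_lt1 ?powR_gt0//.
  have <- : (1 : R) `^ (- (x - y)^-1) = 1 by rewrite powR1.
  apply: gt0_ltr_powR; rewrite ?oppr_gt0 ?nnegrE//; exact: ltW.
have := h e; rewrite e0 e1 => /(_ isT).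
have -> : e `^ x = e `^ (x - y) * e `^ y.
  by rewrite -powRD ?subrK// (gt_eqF e0) implybT.
rewrite mulrA ler_pM2r ?powR_gt0// /e -powRrM mulVf; last first.
  by rewrite lt_eqF// subr_lt0.
by rewrite (powRr1 (ltW M0)) /M mulrDr mulrCA divff ?gt_eqF// !mulr1; lra.
Qed.

(** A single [t] is used with discs of radius comparable to the inverse of [e]: means are bounded
    below, while both areas grow like the square of the radius. *)
Lemma tested_large_disc E u v : E `<=` [set t | 1 <= t <= 2] -> E !=set0 ->
  tested E u v -> v <= u.
Proof.
move=> E12 [t Et] [C C0 hC]; have pi0 := @pi_gt0 R.
have /andP[t1 t2] := E12 _ Et.
suff : - 2 * u <= - 2 * v by lra.
have l0 : 0 < 1 / (2 * pi) :> R by rewrite divr_gt0// mulr_gt0.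
apply: (@exponent_le (1 / (2 * pi)) (C * 256 `^ u)) => // e /andP[e0 e1].
have i1 : 1 < e^-1 by rewrite invf_gt1.
have i0 : 0 < e^-1 by lra.
have i2 : 0 < e^-1 ^+ 2 by rewrite exprn_gt0.
have P w : e `^ (- 2 * w) = (e^-1 ^+ 2) `^ w.
  by rewrite powRrM powR_invn ?(ltW e0)// exprVn.
have K0 : 0 <= 256 :> R by lra.
rewrite !P -mulrA -(powRM _ K0 (ltW i2)).
apply: (hC 0 (2 * (2 * e^-1)) _ _ _ (qannulus (e^-1) (e^-1))) => //.
- lra.
- exact: measurable_qannulus.
- by rewrite expr2 leb2_qannulus_ge// ltW.
- apply: le_trans (leb2_disc_le _) _; first by lra.
  by rewrite lee_fin; lra.
- move=> z [z1 z2 /andP[n1 n2]]; exists t => //.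
  apply: circavg_disc_ge => //; lra.
Qed.

(** The annulus test with one point and [r = e]. *)
Lemma tested_le_double E u v : E `<=` [set t | 1 <= t <= 2] -> E !=set0 ->
  tested E u v -> u <= 2 * v.
Proof.
move=> E12 [t Et] /(tested_annulus E12)[C C0 h].
apply: (@exponent_le 1 C) => // e /andP[e0 e1].
have := h e e t 1%N (fun=> t); rewrite e0 lexx divff ?gt_eqF// powR1 !mul1r.
have -> : (e * e) `^ v = e `^ (2 * v) by rewrite -expr2 powRrM powR_mulrn// ltW.
apply => //; first exact: ltW.
  by move=> i _; split => //; rewrite /ival/=; apply/andP; lra.
by move=> i j /andP[ij]; rewrite ltnS leqn0 => /eqP j0; rewrite j0 in ij.
Qed.

End Testing.

(** * Covering numbers and dimension bounds *)

Section Covering.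
Context {R : realType}.
Implicit Types (E F : set R) (u v e r x y s : R).

Lemma powR_le_root x y v : 0 < v -> 0 <= x -> x `^ v <= y -> x <= y `^ v^-1.
Proof.
move=> v0 x0 xy; rewrite -[leLHS](powRr1 x0) -(mulfV (lt0r_neq0 v0)) powRrM.
by apply: ge0_ler_powR; rewrite ?nnegrE ?powR_ge0 ?invr_ge0 ?(ltW v0)//
  (le_trans _ xy)// powR_ge0.
Qed.

Lemma le0_ler_powR x y s : s <= 0 -> 0 < x -> x <= y -> y `^ s <= x `^ s.
Proof.
move=> s0 x0 xy; rewrite -(opprK s) !(powRN _ (- s)).
have y0 : 0 < y by exact: lt_le_trans xy.
rewrite lef_pV2 ?posrE ?powR_gt0//.
by apply: ge0_ler_powR; rewrite ?nnegrE ?oppr_ge0 ?(ltW x0) ?(ltW y0).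
Qed.

Lemma powRD_pos x s y : 0 < x -> x `^ (s + y) = x `^ s * x `^ y.
Proof. by move=> x0; rewrite powRD// (gt_eqF x0) implybT. Qed.

Lemma powR_div e r s : 0 < e -> 0 < r -> (e / r) `^ s = e `^ s * r `^ (- s).
Proof.
move=> e0 r0; rewrite powRM ?invr_ge0 ?(ltW e0) ?(ltW r0)//.
by rewrite -(powR_inv1 (ltW r0)) -powRrM mulN1r.
Qed.

Lemma coverN_mono F G e : F `<=` G -> (coverN F e <= coverN G e)%E.
Proof.
move=> FG; apply: ereal_inf_le_tmp => _ [n [a Ga] <-].
by exists n => //; exists a; exact: subset_trans FG Ga.
Qed.

Lemma coverN_le_card F e n (a : nat -> R) :
  F `<=` \bigcup_(i in `I_n) [set y | a i <= y <= a i + e] ->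
  (coverN F e <= n%:R%:E)%E.
Proof. by move=> Fa; apply: ereal_inf_lbound; exists n => //; exists a. Qed.

Lemma coverN_ge1 F e : F !=set0 -> (1 <= coverN F e)%E.
Proof.
move=> [y Fy]; apply: le_ereal_inf_tmp => _ [n [a Fa] <-].
by have [i /= ni _] := Fa _ Fy; rewrite lee_fin ler1n (leq_ltn_trans _ ni).
Qed.

(* A maximal e-separated subset yields a cover with two intervals per point. *)
Lemma coverN_le_separated F e M : 0 < e -> 0 <= M ->
  (forall k (a : nat -> R), (0 < k)%N -> (forall i, (i < k)%N -> F (a i)) ->
     (forall i j, (i < j < k)%N -> e < `|a i - a j|) -> k%:R <= M) ->
  (coverN F e <= (2 * M)%:E)%E.
Proof.
move=> e0 M0 FM.
pose sep k (a : nat -> R) := (forall i, (i < k)%N -> F (a i)) /\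
  (forall i j, (i < j < k)%N -> e < `|a i - a j|).
pose P k := `[< exists a, sep k a >].
have P0 : exists k, P k.
  exists 0%N; apply/asboolP; exists (fun=> 0); split=> // i j.
  by rewrite ltn0 andbF.
have Pb k : P k -> (k <= Num.truncn M)%N.
  move=> /asboolP[a [Fa sa]]; case: k Fa sa => // k Fa sa.
  by rewrite -(@natrK R k.+1) le_truncn// (FM _ a _ Fa sa).
have [k /asboolP[a [Fa sa]] kmax] := ex_maxnP P0 Pb.
have kM : k%:R <= M.
  by case: k Fa sa {kmax} => // k Fa sa; exact: (FM _ a _ Fa sa).
(* The first [k] intervals lie to the right of the points [a i], the next [k] to their left. *)
pose b i := if (i < k)%N then a i else a (i - k)%N - e.
apply: (@le_trans _ _ (k + k)%:R%:E); last first.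
  by rewrite lee_fin natrD; lra.
apply: (@coverN_le_card _ _ _ b) => y Fy.
have [i ik yi] : exists2 i, (i < k)%N & `|y - a i| <= e.
  apply: contrapT => H.
  (* A point farther than [e] from every [a i] could be adjoined, against maximality of [k]. *)
  have /kmax : P k.+1; last by rewrite ltnn.
  apply/asboolP; exists (fun i => if (i < k)%N then a i else y).
  split=> [i _|i j].
    by case: ifPn => // /Fa.
  move=> /andP[ij]; rewrite ltnS leq_eqVlt => /orP[/eqP jk|jk].
    rewrite -jk ij ltnn; rewrite ltNge; apply/negP => h; apply: H.
    by exists i; [rewrite -jk|rewrite distrC].
  by rewrite jk (ltn_trans ij jk) sa// ij.
move: yi; rewrite ler_norml => /andP[h1 h2].
have [ay|ya] := leP (a i) y.
  exists i; first by rewrite /= ltn_addl.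
  by rewrite /b/= ik; apply/andP; lra.
exists (k + i)%N; first by rewrite /= ltn_add2l.
by rewrite /b/= ltnNge leq_addr/= addKn; apply/andP; lra.
Qed.

Lemma coverN_ival_le F x r e : 0 < e <= r ->
  (coverN (F `&` ival x r) e <= (2 * (r / e))%:E)%E.
Proof.
move=> /andP[e0 er].
have re0 : 0 <= r / e by rewrite divr_ge0//; lra.
have re1 : 1 <= r / e by rewrite ler_pdivlMr// mul1r.
have tr y : 0 <= y -> (Num.truncn y)%:R <= y < (Num.truncn y)%:R + 1.
  by move=> y0; have := truncn_itv y0; rewrite -natr1.
apply: (@le_trans _ _ (Num.truncn (r / e)).+1%:R%:E); last first.
  by have /andP[] := tr _ re0; rewrite lee_fin -natr1; lra.
apply: (@coverN_le_card _ _ _ (fun i => x + i%:R * e)) => y [_ /andP[h1 h2]].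
have y0 : 0 <= (y - x) / e by rewrite divr_ge0 ?subr_ge0// ltW.
have /andP[k1 k2] := tr _ y0.
exists (Num.truncn ((y - x) / e)).
  by rewrite /= ltnS le_truncn// ler_pM2r ?invr_gt0//; lra.
move: k1 k2; rewrite ler_pdivlMr// ltr_pdivrMr//= => k1 k2.
by apply/andP; split; nra.
Qed.

(** The infimum runs over positive exponents while [s] may vanish, so [s + d] is tested for every
    [d > 0]. Nonemptiness gives covering numbers at least 1, hence [s >= 0]. *)
Lemma dimM_le E C s : E !=set0 ->
  (forall e, 0 < e < 1 -> (coverN E e <= (C * e `^ (- s))%:E)%E) ->
  (dimM E <= s%:E)%E.
Proof.
move=> E0 H.
have s0 : - s <= 0.
  apply: (@exponent_le _ 1 C) => // e e01; rewrite powRr0 mul1r -lee_fin.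
  exact: le_trans (coverN_ge1 e E0) (H _ e01).
apply/lee_addgt0Pr => d d0; apply: ereal_inf_lbound; exists (s + d) => //.
split; first lra.
exists (Num.max C 0) => e e01; apply: (le_trans (H _ e01)).
have /andP[e0 e1] := e01; rewrite lee_fin.
apply: (@le_trans _ _ (Num.max C 0 * e `^ (- s))).
  by rewrite ler_wpM2r ?powR_ge0// le_max lexx.
rewrite ler_wpM2l ?le_max ?lexx ?orbT//.
by apply: ger_powR; [rewrite e0 ltW|lra].
Qed.

(** [dimA] allows intervals of any length. Since [E] lies in [[1, 2]], those longer than 1 reduce to
    that interval, and for [e > 1] a single covering interval is enough. *)
Lemma dimA_le E C s : E `<=` [set t | 1 <= t <= 2] -> 0 <= s ->
  (forall x r e, 0 < e <= r -> r <= 1 ->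
     (coverN (E `&` ival x r) e <= (C * (e / r) `^ (- s))%:E)%E) ->
  (dimA E <= s%:E)%E.
Proof.
move=> E12 s0 H.
apply/lee_addgt0Pr => d d0; apply: ereal_inf_lbound; exists (s + d) => //.
split; first lra.
exists (Num.max C 1) => x r e /andP[e0 er].
have r0 : 0 < r by exact: lt_trans er.
have er0 : 0 < e / r by rewrite divr_gt0.
have er1 : e / r <= 1 by rewrite ler_pdivrMr// mul1r ltW.
have C1 : 0 <= Num.max C 1 by rewrite le_max ler01 orbT.
suff : (coverN (E `&` ival x r) e <= (Num.max C 1 * (e / r) `^ (- s))%:E)%E.
  move=> h; apply: (le_trans h); rewrite lee_fin ler_wpM2l//.
  by apply: ger_powR; [rewrite er0 er1|lra].
have [r1|r1] := leP r 1.
  apply: (le_trans (H _ _ _ _ r1)); first by rewrite e0 ltW.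
  by rewrite lee_fin ler_wpM2r ?powR_ge0// le_max lexx.
have s1 : E `&` ival x r `<=` E `&` ival 1 1.
  by move=> y [/[dup] Ey /E12/andP[h1 h2] _]; split=> //; apply/andP; lra.
apply: (le_trans (coverN_mono e s1)).
have [e1|e1] := leP e 1.
  apply: (@le_trans _ _ (C * (e / 1) `^ (- s))%:E).
    by apply: H; rewrite ?e0.
  rewrite divr1 lee_fin; apply: (@le_trans _ _ (Num.max C 1 * e `^ (- s))).
    by rewrite ler_wpM2r ?powR_ge0// le_max lexx.
  rewrite ler_wpM2l//; apply: le0_ler_powR => //; first lra.
  by rewrite ler_pdivrMr//; nra.
apply: (@le_trans _ _ 1%:R%:E).
  apply: (@coverN_le_card _ _ _ (fun=> 1)) => y [_ /andP[h1 h2]].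
  by exists 0%N => //=; apply/andP; lra.
rewrite lee_fin -[leLHS]mul1r; apply: ler_pM => //.
  by rewrite le_max lexx orbT.
rewrite -[leLHS](powRr0 (e / r)); apply: ger_powR; first by rewrite er0 er1.
lra.
Qed.

(** The interval [[1, 2]] contains [E] and its length 1 is admissible for every [theta >= 0]. *)
Lemma dimAspec_ge_dimM E theta : E `<=` [set t | 1 <= t <= 2] -> 0 <= theta ->
  (dimM E <= dimAspec E theta)%E.
Proof.
move=> E12 t0; apply: ereal_inf_le_tmp => _ [a [a0 [c H]] <-].
exists a => //; split=> //; exists c => e /[dup] e01 /andP[e0 e1].
rewrite -[e in e `^ _]divr1; apply: le_trans (H e 1 1 e01 _); last first.
  rewrite -[leRHS](powRr0 e); apply: ger_powR => //; by rewrite e0 ltW.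
apply: coverN_mono => y /[dup] Ey /E12/andP[h1 h2]; split=> //.
by apply/andP; lra.
Qed.

Lemma dimAspec_le1 E theta : theta <= 1 -> (dimAspec E theta <= 1%:E)%E.
Proof.
move=> t1; apply: ereal_inf_lbound; exists 1 => //; split=> //.
exists 2 => e x r /andP[e0 e1] er.
have {}er : e <= r.
  apply: le_trans er; rewrite -[leLHS](powRr1 (ltW e0)).
  by apply: ger_powR; [rewrite e0 ltW|].
have r0 : 0 < r by exact: lt_le_trans er.
have := @coverN_ival_le E x r e; rewrite e0 er => /(_ isT).
by rewrite powR_inv1 ?divr_ge0 ?(ltW e0) ?(ltW r0)// invf_div.
Qed.

(** The disc estimate is solved for the number of separated points, which controls the covering
    number. *)
Lemma tested_coverN E u v : E `<=` [set t | 1 <= t <= 2] -> tested E u v ->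
  0 < v -> exists C : R, forall e, 0 < e <= 1 ->
    (coverN E e <= (C * e `^ ((2 * u - 1) / v - 1))%:E)%E.
Proof.
move=> E12 T v0; have [C C0 H] := tested_disc E12 T.
exists (2 * C `^ v^-1) => e /[dup] e01 /andP[e0 e1].
rewrite -mulrA; apply: coverN_le_separated => //.
  by rewrite mulr_ge0 ?powR_ge0.
move=> k a k0 Ea sep; have := H _ _ _ e01 k0 Ea sep.
have -> : e `^ (2 * u) = e * e `^ (2 * u - 1).
  have -> : e * e `^ (2 * u - 1) = e `^ 1 * e `^ (2 * u - 1).
    by rewrite (powRr1 (ltW e0)).
  by rewrite -powRD_pos//; congr powR; ring.
rewrite mulrCA ler_pM2l// => h.
have {}h : k%:R * e <= (C * e `^ (2 * u - 1)) `^ v^-1.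
  by apply: powR_le_root => //; rewrite mulr_ge0 ?ler0n ?(ltW e0).
move: h; rewrite powRM ?powR_ge0// -powRrM.
by rewrite powRD_pos// (powR_inv1 (ltW e0)) mulrA ler_pdivlMr.
Qed.

Lemma tested_coverN_ival E u v : E `<=` [set t | 1 <= t <= 2] ->
  tested E u v -> 0 < v -> exists2 C : R, 0 <= C &
    forall x r e, 0 < e <= r -> r <= 1 ->
    (coverN (E `&` ival x r) e <=
      (C * (e `^ ((u - v - 2^-1) / v) * r `^ ((2^-1 - v) / v)))%:E)%E.
Proof.
move=> E12 T v0; have [C C0 H] := tested_annulus E12 T.
exists (2 * C `^ v^-1); first by rewrite mulr_ge0 ?powR_ge0.
move=> x r e /[dup] er /andP[e0 er'] r1; have r0 : 0 < r by lra.
rewrite -mulrA; apply: coverN_le_separated => //.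
  by rewrite !mulr_ge0 ?powR_ge0.
move=> k a k0 Ea sep; have := H _ _ _ _ _ er r1 k0 Ea sep.
have k0' : 0 <= k%:R :> R by rewrite ler0n.
rewrite powR_div//.
have -> : e `^ u = e `^ 2^-1 * e `^ (u - 2^-1).
  by rewrite -powRD_pos//; congr powR; ring.
rewrite -[leLHS]mulrA [leRHS]mulrCA ler_pM2l ?powR_gt0//.
rewrite powRN mulrC ler_pdivrMr ?powR_gt0// => h.
have {}h : k%:R * (r * e) <= (C * e `^ (u - 2^-1) * r `^ 2^-1) `^ v^-1.
  by apply: powR_le_root => //; rewrite mulr_ge0// mulr_ge0// ltW.
move: h; rewrite !powRM ?mulr_ge0 ?powR_ge0// -!powRrM.
have -> : (u - v - 2^-1) / v = (u - 2^-1) / v - 1 by field; rewrite gt_eqF.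
have -> : (2^-1 - v) / v = 2^-1 / v - 1 by field; rewrite gt_eqF.
rewrite !powRD_pos// !(powR_inv1 (ltW _))//.
set a1 := C `^ _; set a2 := e `^ _; set a3 := r `^ _ => h.
rewrite (_ : a1 * _ = (a1 * a2 * a3) / (r * e)); last first.
  by field; rewrite !gt_eqF.
by rewrite ler_pdivlMr// mulr_gt0.
Qed.

End Covering.

(** * Constraints on the exponents and the quadrilateral *)

Section Exponents.
Context {R : realType}.
Implicit Types (E : set R) (u v beta gamma : R).

(** Comparing exponents in [tested_coverN]; equality is the line through [ptQ1] and [ptQ3]. *)
Lemma tested_dimM E u v beta : E `<=` [set t | 1 <= t <= 2] -> E !=set0 ->
  dimM E = beta%:E -> tested E u v -> 0 < v -> 2 * u + (beta - 1) * v <= 1.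
Proof.
move=> E12 E0 Eb T v0; have [C H] := tested_coverN E12 T v0.
have : (dimM E <= (- ((2 * u - 1) / v - 1))%:E)%E.
  apply: (@dimM_le _ _ C) => // e /andP[e0 e1]; rewrite opprK; apply: H.
  by rewrite e0 ltW.
rewrite Eb lee_fin => h.
have {}h : (2 * u - 1) / v <= 1 - beta by lra.
by move: h; rewrite ler_pdivrMr//; lra.
Qed.

Lemma near_quadratic_gt0 (p0 p1 p2 : R) : 0 < p0 ->
  \forall e \near 0^'+, 0 < p0 + p1 * e + p2 * e ^+ 2.
Proof.
move=> p00; pose K := `|p1| + `|p2| + 1.
have K0 : 0 < K by rewrite /K; have := normr_ge0 p1; have := normr_ge0 p2; lra.
near=> e.
have e0 : 0 < e by near: e; exact: nbhs_right_gt.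
have e1 : e < 1 by near: e; exact: nbhs_right_lt.
have : e < p0 / K by near: e; apply: nbhs_right_lt; rewrite divr_gt0.
rewrite ltr_pdivlMr// /K.
have := ler_norm (- p1); have := ler_norm (- p2); rewrite !normrN => h2 h1 h.
have k1 : - p1 * e <= `|p1| * e by rewrite ler_wpM2r// ltW.
have k2 : - p2 * e ^+ 2 <= `|p2| * e ^+ 2 by rewrite ler_wpM2r// sqr_ge0.
have k3 : `|p2| * e ^+ 2 <= `|p2| * e by rewrite ler_wpM2l//; nra.
lra.
Unshelve. all: by end_near. Qed.

(* If the inequality failed, then for a close to gamma and theta close to
   1 - beta / gamma, intervals longer than delta ^ (1 - (beta + e) / a) would be
   controlled by the Minkowski bound and the shorter ones by the annulus test,
   giving dimAspec E theta <= a < gamma. *)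
Lemma tested_dimAspec E u v beta gamma :
  E `<=` [set t | 1 <= t <= 2] -> dimM E = beta%:E -> tested E u v -> 0 < v ->
  0 < beta -> beta < gamma ->
  (forall theta, 1 - beta / gamma < theta < 1 ->
     dimAspec E theta = gamma%:E) ->
  u <= v * (2 - beta - beta / gamma) + beta / (2 * gamma).
Proof.
move=> E12 Eb T v0 b0 bg reg; have g0 : 0 < gamma by lra.
rewrite leNgt; apply/negP => lt.
have [C C0 HC] := tested_coverN_ival E12 T v0.
set A := (u - v - 2^-1) / v in HC; set B := (2^-1 - v) / v in HC.
pose th0 := 1 - beta / gamma.
have th0g : th0 * gamma = gamma - beta.
  by rewrite /th0 mulrBl mul1r divfK// gt_eqF.
(* The failed inequality says that at [r] equal to [delta] to the power [th0] the annulus bound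
   beats [delta] to the power [- beta]. *)
have D0 : 0 < A + th0 * B + beta.
  have -> : A + th0 * B + beta =
      (u - (v * (2 - beta - beta / gamma) + beta / (2 * gamma))) / v.
    by rewrite /A /B /th0; field; rewrite !gt_eqF.
  by rewrite divr_gt0// subr_gt0.
have th00 : 0 < th0 by rewrite /th0 subr_gt0 ltr_pdivrMr// mul1r.
have th01 : th0 < 1 by rewrite /th0 ltrBlDr ltrDl divr_gt0.
have p1 : 0 < gamma * (A + th0 * B + beta) by rewrite mulr_gt0.
(* The last two conditions are [tauP] and [thP] below, expanded in [e]; their constant terms are
   positive by [D0]. *)
have [e [e0 e1 e2 e3 e4]] : exists e,
    [/\ 0 < e, e < 1 - th0, 2 * e < gamma - beta,
    0 < gamma * (A + th0 * B + beta) +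
      (- (2 * gamma + A) + 2 * (gamma - B) + (gamma - beta)) * e + -1 * e ^+ 2 &
    0 < (A + th0 * B + beta) + (th0 - 1 - (gamma - B)) * e + 1 * e ^+ 2].
  suff : \forall e \near 0^'+, [/\ 0 < e, e < 1 - th0, 2 * e < gamma - beta,
    0 < gamma * (A + th0 * B + beta) +
      (- (2 * gamma + A) + 2 * (gamma - B) + (gamma - beta)) * e + -1 * e ^+ 2 &
    0 < (A + th0 * B + beta) + (th0 - 1 - (gamma - B)) * e + 1 * e ^+ 2].
    by move=> /filter_ex.
  near=> e; split; near: e.
  - exact: nbhs_right_gt.
  - by apply: nbhs_right_lt; rewrite subr_gt0.
  - near=> e.
    have : e < (gamma - beta) / 2 by near: e; apply: nbhs_right_lt; lra.
    lra.
  - exact: near_quadratic_gt0.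
  - exact: near_quadratic_gt0.
pose a := gamma - e; have a0 : 0 < a by rewrite /a; lra.
pose th := th0 + e.
(* At [r] equal to [d] to the power [tau], the Minkowski bound with exponent [beta + e] coincides
   with the target. *)
pose tau := 1 - (beta + e) / a.
have taua : tau * a = a - beta - e.
  by rewrite /tau mulrBl mul1r divfK ?gt_eqF//; ring.
have tau0 : 0 < tau by rewrite -(pmulr_lgt0 _ a0) taua /a; lra.
have tauP : tau * (a - B) <= A + a.
  rewrite -(ler_pM2r a0) mulrAC taua -subr_ge0.
  rewrite (_ : _ - _ = gamma * (A + th0 * B + beta) +
      (- (2 * gamma + A) + 2 * (gamma - B) + (gamma - beta)) * e + -1 * e ^+ 2).
    exact: ltW.
  have -> : beta = gamma - th0 * gamma by rewrite th0g; ring.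
  rewrite /a; ring.
have thP : th * (a - B) <= A + a.
  rewrite -subr_ge0.
  rewrite (_ : _ - _ = (A + th0 * B + beta)
    + (th0 - 1 - (gamma - B)) * e + 1 * e ^+ 2); first exact: ltW.
  have -> : beta = gamma - th0 * gamma by rewrite th0g; ring.
  rewrite /a /th; ring.
have : (dimM E < (beta + e)%:E)%E by rewrite Eb lte_fin; lra.
move=> /ereal_inf_lt[_ [b [bb0 [c Hc]] <-]]; rewrite lte_fin => be.
suff : (dimAspec E th <= a%:E)%E.
  rewrite reg; last by rewrite /th /th0 in e1 *; apply/andP; lra.
  by rewrite lee_fin /a; lra.
apply: ereal_inf_lbound; exists a => //; split=> //.
exists (Num.max c 0 + C) => d x r /[dup] d01 /andP[d0 d1] dr.
have d1' : 0 < d <= 1 by rewrite d0 ltW.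
have r0 : 0 < r by apply: lt_le_trans dr; rewrite powR_gt0.
have dr' : d <= r.
  apply: le_trans dr; rewrite -[leLHS](powRr1 (ltW d0)); apply: ger_powR => //.
  rewrite /th; lra.
have c0 : 0 <= Num.max c 0 by rewrite le_max lexx orbT.
rewrite powR_div// opprK mulrDl.
have [tr|rt] := leP (d `^ tau) r.
  apply: (@le_trans _ _ (coverN E d)).
    by apply: coverN_mono => y [].
  apply: (le_trans (Hc _ d01)); rewrite lee_fin.
  apply: (@le_trans _ _ (Num.max c 0 * (d `^ (- a) * r `^ a))); last first.
    by rewrite lerDl mulr_ge0// mulr_ge0 ?powR_ge0.
  apply: (@le_trans _ _ (Num.max c 0 * d `^ (- b))).
    by rewrite ler_wpM2r ?powR_ge0// le_max lexx.
  apply: ler_wpM2l => //.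
  apply: (@le_trans _ _ (d `^ (- a) * (d `^ tau) `^ a)).
    by rewrite -powRrM -powRD_pos// taua; apply: ger_powR => //; lra.
  rewrite ler_wpM2l ?powR_ge0//; apply: ge0_ler_powR => //; first exact: ltW.
    by rewrite nnegrE powR_ge0.
  by rewrite nnegrE ltW.
have r1 : r <= 1.
  apply: (le_trans (ltW rt)); rewrite -[leRHS](powRr0 d).
  by apply: ger_powR => //; exact: ltW.
have der : 0 < d <= r by rewrite d0.
apply: (le_trans (HC x r d der r1)); rewrite lee_fin.
apply: (@le_trans _ _ (C * (d `^ (- a) * r `^ a))); last first.
  by rewrite lerDr mulr_ge0// mulr_ge0 ?powR_ge0.
apply: ler_wpM2l => //.
(* The right side is monotone in [r], so an endpoint of the range decides: the power [th] of [d] if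
   [a - B] is nonnegative, the power [tau] otherwise. *)
suff h : d `^ (A + a) <= r `^ (a - B).
  have -> : d `^ A = d `^ (- a) * d `^ (A + a).
    by rewrite -powRD_pos//; congr powR; ring.
  have -> : r `^ a = r `^ (a - B) * r `^ B.
    by rewrite -powRD_pos//; congr powR; ring.
  by rewrite mulrA ler_wpM2r ?powR_ge0// ler_wpM2l ?powR_ge0.
have [aB|aB] := leP 0 (a - B).
  apply: (@le_trans _ _ ((d `^ th) `^ (a - B))).
    by rewrite -powRrM; exact: ger_powR.
  apply: ge0_ler_powR => //; first by rewrite nnegrE powR_ge0.
  by rewrite nnegrE ltW.
apply: (@le_trans _ _ ((d `^ tau) `^ (a - B))).
  by rewrite -powRrM; exact: ger_powR.
by apply: le0_ler_powR => //; exact: ltW.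
Unshelve. all: by end_near. Qed.

(* On either side of the ray through Q3, the point (u, v) is a combination of O
   and the two vertices adjacent to that side. *)
Lemma Quad_mem beta gamma u v : 0 <= beta -> gamma <= 1 ->
  beta + 1 <= 2 * gamma -> 0 <= v -> v <= u -> u <= 2 * v ->
  2 * u + (beta - 1) * v <= 1 ->
  (0 < beta -> beta < gamma ->
     u <= v * (2 - beta - beta / gamma) + beta / (2 * gamma)) ->
  Quad beta gamma (u, v).
Proof.
move=> b0 g1 bg v0 vu uv h1 h2.
have g0 : 0 < gamma by lra.
have [th0 th1 thE th_eq1] : [/\ 0 < thetaQ beta gamma, thetaQ beta gamma <= 1,
    2 * (gamma - beta) * thetaQ beta gamma = 1 - beta &
    1 <= beta -> thetaQ beta gamma = 1].
  rewrite /thetaQ; have [b1|b1] := ltP beta 1; last by split => //; lra.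
  have gb : 0 < 2 * (gamma - beta) by lra.
  split => //; [by rewrite divr_gt0//; lra|by rewrite ler_pdivrMr//; lra|].
  by rewrite mulrC divfK// gt_eqF.
rewrite /Quad /ptQ3 /ptO /ptQ1 /ptQ2 /=.
move: (thetaQ beta gamma) th0 th1 thE th_eq1 => th th0 th1 thE th_eq1.
(* In this notation [ptQ3] is [(P / (2 * D), 1 / (2 * D))], so the ray through it is [u = P * v]. *)
pose D := 1 + gamma * th; pose P := 2 - beta * (1 - th).
have D0 : 0 < D by rewrite /D; nra.
have P1 : 0 < P - 1 by rewrite /P; nra.
have Dn : 1 + gamma * th != 0 by rewrite gt_eqF.
have bn : 1 + beta != 0 by rewrite gt_eqF//; lra.
have gn : 1 + gamma != 0 by rewrite gt_eqF//; lra.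
have gn' : 3 + (2 * gamma - 1) != 0 by rewrite gt_eqF//; lra.
have [uP|Pu] := leP u (P * v).
  have Pn : P - 1 != 0 by rewrite gt_eqF.
  (* The weights at [ptQ1] and [ptQ3] sum to the left side of [h1], thanks to the equation [thE] for
     [th]. *)
  have sE : (1 + beta) * (P * v - u) / (P - 1) + 2 * D * (u - v) / (P - 1) =
      2 * u + (beta - 1) * v.
    rewrite -mulrDl; apply: (mulIf Pn); rewrite divfK//.
    apply/eqP; rewrite -subr_eq0.
    rewrite (_ : _ - _ = (2 * (gamma - beta) * th - (1 - beta)) * (u - v)).
      by rewrite thE subrr mul0r.
    by rewrite /D /P; ring.
  exists (1 - (2 * u + (beta - 1) * v)), ((1 + beta) * (P * v - u) / (P - 1)),
    (2 * D * (u - v) / (P - 1)), 0.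
  split; first lra.
  split; first by rewrite divr_ge0 ?(ltW P1)// mulr_ge0; lra.
  split; first by rewrite divr_ge0 ?(ltW P1)// mulr_ge0; lra.
  split => //; split; first by rewrite -sE; ring.
  by split; rewrite /D /P in Pn *; field; rewrite Pn Dn bn gn'.
(* Beyond the ray, [P * v < u <= 2 * v]; this forces [beta > 0], [th < 1] and [beta < gamma], which
   makes [h2] available. *)
have P2 : 0 < 2 - P.
  rewrite ltNge; apply/negP => P2.
  have : 0 <= (P - 2) * v by rewrite mulr_ge0//; lra.
  lra.
have bt : 0 < beta * (1 - th) by rewrite /P in P2; lra.
have bp : 0 < beta by nra.
have b1 : beta < gamma.
  have [b1|/th_eq1 th_eq] := ltP beta 1; first lra.
  by move: bt; rewrite th_eq subrr mulr0 ltxx.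
have Pn : 2 - P != 0 by rewrite gt_eqF.
have {}h2 := h2 bp b1.
(* The weights of [(u, v)] at [ptQ3] and [ptQ2]; that their sum is at most 1 is a rescaling of
   [h2]. *)
pose c := 2 * D * (2 * v - u) / (2 - P).
pose d := (2 + 2 * gamma) * (u - P * v) / (2 - P).
have sE : c + d <= 1.
  rewrite /c /d -mulrDl ler_pdivrMr// mul1r.
  have -> : 2 * D * (2 * v - u) + (2 + 2 * gamma) * (u - P * v) =
    (1 - th) * (2 * gamma * (u - v * (2 - beta - beta / gamma))).
    by rewrite /D /P; field; rewrite gt_eqF.
  have -> : 2 - P = (1 - th) * beta by rewrite /P; ring.
  apply: ler_wpM2l; first lra.
  rewrite mulrC -ler_pdivlMr; last by lra.
  lra.
exists (1 - (c + d)), 0, c, d.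
split; first lra.
split => //.
split; first by rewrite /c divr_ge0 ?(ltW P2)// mulr_ge0; lra.
split; first by rewrite /d divr_ge0 ?(ltW P2)// mulr_ge0; lra.
split; first by ring.
by split; rewrite /c /d /D /P in Pn *; field; rewrite Pn Dn bn gn'.
Qed.

End Exponents.

(** * Necessary conditions for restricted weak type and for the type set *)

Theorem theorem1p4 (R : realType) (E : set R) (beta gamma gammas : R) :
  E `<=` [set t : R | 1 <= t <= 2] -> E !=set0 ->
  dimM E = beta%:E ->
  dimAspec E theta @[theta --> 1^'-] --> gamma%:E ->
  dimA E = gammas%:E ->
  (forall p : R, 1 <= p -> rad_restricted_weak E p (2 * p) ->
     Num.max ((beta + 3) / 2) (gammas + 1) <= p) /\
  (qA_regular E beta gamma -> beta + 1 <= 2 * gamma ->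
     Trad E `<=` Quad beta gamma).
Proof.
move=> E12 E0 Eb Eg Egs; split=> [p p1 W|reg bg [u v]].
  have p0 : 0 < p by lra.
  have T := tested_of_rad_restricted_weak p1 W.
  have v0 : 0 < (2 * p)^-1 by rewrite invr_gt0; lra.
  rewrite ge_max; apply/andP; split.
    have := tested_dimM E12 E0 Eb T v0.
    have -> : 2 * p^-1 + (beta - 1) * (2 * p)^-1 = (beta + 3) / 2 / p.
      by field; rewrite gt_eqF.
    by rewrite ler_pdivrMr// mul1r.
  have [C _ H] := tested_coverN_ival E12 T v0.
  have : (dimA E <= (p - 1)%:E)%E.
    apply: (@dimA_le _ _ C) => //; first lra.
    move=> x r e er r1; have /andP[e0 er'] := er.
    have r0 : 0 < r by exact: lt_le_trans er'.
    rewrite powR_div// opprK; have := H x r e er r1.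
    (* When [q = 2p] the exponents of [e] and [r] are opposite, so the bound depends on [e / r]
       only, as in the Assouad dimension. *)
    have -> : (p^-1 - (2 * p)^-1 - 2^-1) / (2 * p)^-1 = - (p - 1).
      by field; rewrite gt_eqF.
    have -> : (2^-1 - (2 * p)^-1) / (2 * p)^-1 = p - 1.
      by field; rewrite gt_eqF.
    by [].
  by rewrite Egs lee_fin; lra.
move=> [/= /andP[u0 u1] [/andP[v0 v1] B]].
have T := tested_of_rad_bounded u0 v0 B.
have b0 : 0 <= beta.
  rewrite -lee_fin -Eb; apply: le_ereal_inf_tmp => _ [a [a0 _] <-].
  by rewrite lee_fin ltW.
have g1 : gamma <= 1.
  rewrite -lee_fin; apply: cvge_le Eg; near=> theta.
  by apply: dimAspec_le1; near: theta; exact: nbhs_left_le.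
have bleg : beta <= gamma.
  rewrite -lee_fin -Eb; apply: cvge_ge Eg; near=> theta.
  apply: dimAspec_ge_dimM => //; near: theta.
  by apply: nbhs_left_ge; exact: ltr01.
have vu := tested_large_disc E12 E0 T.
have uv := tested_le_double E12 E0 T.
have g0 : 0 < gamma by lra.
(* The covering estimates divide by [v]; at [v = 0] the bound [u <= 2 * v] leaves only the
   origin. *)
have [v_eq0|vn0] := eqVneq v 0.
  apply: Quad_mem => //; rewrite v_eq0 in uv *; first lra.
  by move=> bp _; rewrite mul0r add0r (le_trans uv)// mulr0 divr_ge0//; lra.
have vp : 0 < v by rewrite lt_neqAle eq_sym vn0.
apply: Quad_mem => //; first exact: tested_dimM Eb T vp.
move=> bp bltg; apply: tested_dimAspec E12 Eb T vp bp bltg _.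
(* The alternative [gamma = 0] contradicts [2 * gamma >= beta + 1 >= 1]. *)
by case: reg => // g_eq0; rewrite g_eq0 ltxx in g0.
Unshelve. all: by end_near. Qed.
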